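(* Let $R$ be a commutative ring with identity, let $n\geq 2$ and $m\geq 2$ be integers, and let $f_1,\dots,f_m\in R[X]$ be monic polynomials of degree $n$ with companion matrices $C_{f_1},\dots,C_{f_m}\in M_n(R)$. Then $R\langle C_{f_1},\dots,C_{f_m}\rangle=M_n(R)$ if and only if $f_1,\dots,f_m$ are relatively prime when reduced modulo every maximal ideal of $R$; that is, for every maximal ideal $\mathfrak m$ of $R$, the reductions of $f_1,\dots,f_m$ in $(R/\mathfrak m)[X]$ have (jointly) greatest common divisor $1$.
   Context: The companion matrix of a monic polynomial $f=f_0+f_1X+\cdots+f_{n-1}X^{n-1}+X^n\in R[X]$ is the matrix in $M_n(R)$ whose $j$-th column is $e_{j+1}$ for $1\leq j\leq n-1$ and whose last column is $(-f_0,-f_1,\dots,-f_{n-1})^t$, where $e_1,\dots,e_n$ is the canonical basis of the column space $R^n$. For $S\subseteq M_n(R)$, $R\langle S\rangle$ denotes the (unital) $R$-subalgebra of $M_n(R)$ generated by $S$. *)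

(* Defs.v *)
From HB Require Import structures.
From mathcomp Require Import all_boot all_order all_algebra.
From mathcomp Require Import boolp classical_sets.

Set Implicit Arguments.
Unset Strict Implicit.
Unset Printing Implicit Defensive.

Import GRing.Theory.
Local Open Scope ring_scope.
Local Open Scope quotient_scope.

(* Meant for f monic of degree n, i.e., size f = n.+1. This is the transpose of
   mxpoly's companionmx, whose dimension is moreover (size f).-1 rather than a
   given n. With 0-based indices, column j is the basis vector of index j.+1 for
   j < n.-1, and the last column is (- f_0, ..., - f_(n-1))^T. *)
Definition companion_col (R : nzRingType) (n : nat) (f : {poly R}) : 'M[R]_n :=
  \matrix_(i < n, j < n)
    if j.+1 == n :> nat then - f`_i else (i == j.+1 :> nat)%:R.

(* GRing.subalg_closed spelled out: 'M[R]_n is a lalgType in the library only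
   for n of the form n'.+1. *)
Definition mx_subalg (R : comPzRingType) (n : nat) (A : set 'M[R]_n) : Prop :=
  [/\ A 1%:M,
      forall (a : R) (B C : 'M[R]_n), A B -> A C -> A (a *: B + C)
    & forall B C : 'M[R]_n, A B -> A C -> A (B *m C)].

Definition gen_subalg (R : comPzRingType) (n : nat) (S : set 'M[R]_n) :
    set 'M[R]_n :=
  smallest (@mx_subalg R n) S.

(* The elements of idealr R are proper by definition. Ideals are boolean
   predicates there, which classically (boolp) covers all ideals of R. *)
Definition maximal_ideal (R : comNzRingType) (I : idealr R) : Prop :=
  forall J : idealr R, {subset I <= J} -> {subset J <= I}.

Definition residue_field (R : comNzRingType) (I : idealr R)
  (maxI : maximal_ideal I) : Type := {ideal_quot I}.

Section ResidueField.
Variables (R : comNzRingType) (I : idealr R) (maxI : maximal_ideal I).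
Local Notation K := (residue_field maxI).

HB.instance Definition _ := GRing.ComNzRing.on K.

Lemma residue_unit_ex (x : K) : x != 0 -> exists y : K, y * x == 1.
Proof.
rewrite -[x]reprK; move: (repr x) => a a_neq0.
have aNI : a \notin I.
  by apply: contra a_neq0 => aI; rewrite -(rmorph0 \pi_{ideal_quot I})
    -Quotient.idealrBE subr0.
pose S : R -> bool := fun u => `[< exists b, exists2 c, c \in I & u = b * a + c >].
apply: contrapT => /forallNP noinv.
have Sid : idealr_closed S.
  split.
  - by apply/asboolP; exists 0, 0; rewrite ?rpred0 // mul0r addr0.
  - apply/negP => /asboolP[b [c cI def1]].
    apply: (noinv (\pi_{ideal_quot I} b)).
    have : b * a == 1 %[mod {ideal_quot I}].
      by rewrite -Quotient.idealrBE def1 opprD addNKr rpredN.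
    by rewrite rmorphM rmorph1.
  - move=> r u v /asboolP[b [c cI ->]] /asboolP[b' [c' c'I ->]].
    apply/asboolP; exists (r * b + b'), (r * c + c').
      by rewrite rpredD // idealMr.
    by rewrite mulrDr mulrDl -mulrA addrACA.
pose mS := isIdealr.Build R S Sid.
pose J : idealr R := HB.pack S mS.
have sIJ : {subset I <= J}.
  by move=> c cI; apply/asboolP; exists 0, c; rewrite // mul0r add0r.
have aJ : a \in J by apply/asboolP; exists 1, 0; rewrite ?rpred0 // mul1r addr0.
by rewrite (maxI sIJ aJ) in aNI.
Qed.

Definition residue_inv (x : K) : K :=
  match boolP (x != 0) with
  | AltTrue x_neq0 => xchoose (residue_unit_ex x_neq0)
  | AltFalse _ => 0
  end.

Lemma residue_mulVf (x : K) : x != 0 -> residue_inv x * x = 1.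
Proof.
move=> x_neq0; rewrite /residue_inv; case: {-}_ / boolP => [nz|]; last first.
  by rewrite x_neq0.
exact/eqP/(xchooseP (residue_unit_ex nz)).
Qed.

Lemma residue_inv0 : residue_inv 0 = 0.
Proof. by rewrite /residue_inv; case: {-}_ / boolP => // p; case/eqP: (p). Qed.

HB.instance Definition _ :=
  GRing.ComNzRing_isField.Build K residue_mulVf residue_inv0.

(* \pi as a map into the residue field K rather than {ideal_quot I} *)
Definition residue (a : R) : K := \pi_{ideal_quot I} a.

HB.instance Definition _ := GRing.RMorphism.copy residue \pi_{ideal_quot I}.

End ResidueField.

Arguments residue {R I} maxI a.

(* Main.v *)
(* Write A for the generated algebra, C_i for the companion matrix of f_i, and
   e_0, ..., e_(n-1) for the canonical basis.

   If g divides every f_i over a residue field, then the row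
   (1, X, ..., X^(n-1)) is, modulo g, a common left eigenvector of the C_i with
   eigenvalue X, hence of all matrices in A; as n >= 2, an elementary matrix
   contradicts this unless g is a unit.

   Conversely, C_i - C_0 = - (f_i(C_0) e_0) e_(n-1)^T, so A contains
   (f(C_0) e_0) e_(n-1)^T for every f in the ideal generated by the f_i. The r
   in R such that r u e_(n-1)^T is in A for all u form an ideal. Given a
   maximal ideal M, lifting a Bezout relation over R/M yields p in the ideal of
   the f_i that is a nonzero constant modulo M; then B = p(C_0) is an invertible
   scalar matrix modulo M, and r = det B works because r u = B (adj B) u is of
   the form (p q)(C_0) e_0. Hence 1 is such an r, and multiplying u e_(n-1)^T
   on the right by C_0 yields the other columns. *)
From HB Require Import structures.
Require Import Defs.
From mathcomp Require Import all_boot all_order all_algebra.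
From mathcomp Require Import boolp classical_sets.

Set Implicit Arguments.
Unset Strict Implicit.
Unset Printing Implicit Defensive.

Import GRing.Theory.
Local Open Scope ring_scope.

(** * Maximal ideals and passage to residue fields *)

Lemma maximal_ideal_above (R : comNzRingType) (I : idealr R) :
  exists2 M : idealr R, maximal_ideal M & {subset I <= M}.
Proof.
pose T := {J : idealr R | {subset I <= J}}.
pose leT (J K : T) := `[< {subset sval J <= sval K} >].
have [|||[M sIM] maxM] := @ZL_preorder T (exist _ I (fun x xI => xI)) leT.
- by move=> J; apply/asboolP.
- by move=> J K L /asboolP sJK /asboolP sKL; apply/asboolP => x /sJK/sKL.
- move=> A Atot.
  (* The empty chain is bounded by [I], a nonempty one by its union, which is proper as no member
     contains 1. *)
  have [[J0 AJ0]|/forallNP noA] := pselect (exists J, A J); last first.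
    by exists (exist _ I (fun x xI => xI)) => s /(noA s).
  pose S : R -> bool := fun u => `[< exists2 J, A J & u \in sval J >].
  have Sid : idealr_closed S.
    split; first by apply/asboolP; exists J0; rewrite ?rpred0.
      by apply/negP => /asboolP[J _]; rewrite idealr1.
    move=> r u v /asboolP[J AJ uJ] /asboolP[K AK vK]; apply/asboolP.
    have [/asboolP sJK|/asboolP sKJ] := Atot J K AJ AK.
      by exists K => //; rewrite rpredD // idealMr ?sJK.
    by exists J => //; rewrite rpredD ?(sKJ v) // idealMr.
  pose mS := isIdealr.Build R S Sid.
  pose U : idealr R := HB.pack S mS.
  have sIU : {subset I <= U}.
    by move=> x xI; apply/asboolP; exists J0; rewrite // (svalP J0).
  exists (exist _ U sIU) => J AJ; apply/asboolP => x xJ.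
  by apply/asboolP; exists J.
exists M => // J sMJ.
have sIJ : {subset I <= J} by move=> x /sIM/sMJ.
by apply/asboolP/(maxM (exist _ J sIJ)); apply/asboolP.
Qed.

Lemma residue_eq0 (R : comNzRingType) (M : idealr R) (maxM : maximal_ideal M)
    (a : R) :
  (residue maxM a == 0) = (a \in M).
Proof.
by rewrite -[a in RHS]subr0 Quotient.idealrBE -(rmorph0 (residue maxM)).
Qed.

Lemma residue_surj (R : comNzRingType) (M : idealr R)
    (maxM : maximal_ideal M) (x : residue_field maxM) :
  exists a : R, residue maxM a = x.
Proof. by exists (repr x); rewrite /residue reprK. Qed.

Lemma map_residue_surj (R : comNzRingType) (M : idealr R)
    (maxM : maximal_ideal M) (p : {poly residue_field maxM}) :
  exists q : {poly R}, map_poly (residue maxM) q = p.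
Proof.
have /choice[g gK] := @residue_surj R M maxM.
exists (\poly_(i < size p) g p`_i); apply/polyP => i.
rewrite coef_map coef_poly; case: ltnP => [_|le_p_i]; first exact: gK.
by rewrite nth_default // raddf0.
Qed.

(** If [P 1] failed, [P] would define a proper ideal, hence lie in a maximal ideal [M], against the
    [r] given for [M]. *)
Lemma ideal_local_global (R : comNzRingType) (P : R -> Prop) :
    P 0 -> (forall a u v, P u -> P v -> P (a * u + v)) ->
    (forall (M : idealr R) (maxM : maximal_ideal M),
       exists2 r, P r & residue maxM r != 0) ->
  P 1.
Proof.
move=> P0 Plin Ploc; apply: contrapT => nP1.
pose S : R -> bool := fun u => `[< P u >].
have Sid : idealr_closed S.
  split; [exact/asboolP | exact/asboolPn |].
  by move=> r u v /asboolP Pu /asboolP Pv; apply/asboolP; apply: Plin.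
pose mS := isIdealr.Build R S Sid.
pose I : idealr R := HB.pack S mS.
have [M maxM sIM] := maximal_ideal_above I.
have [r Pr] := Ploc M maxM; rewrite residue_eq0 => /negP[].
by apply: sIM; apply/asboolP.
Qed.

(** * Gcd and Bezout relations for finite families over a field *)

Lemma big_gcdp_dvd (F : fieldType) (I : finType) (p : I -> {poly F}) (i : I) :
  \big[@gcdp F/0]_j p j %| p i.
Proof.
have : i \in index_enum I by rewrite mem_index_enum.
elim: (index_enum I) => // j s IHs; rewrite big_cons inE.
case/predU1P=> [->|/IHs]; first exact: dvdp_gcdl.
exact/dvdp_trans/dvdp_gcdr.
Qed.

Lemma big_gcdp_bezout (F : fieldType) (I : finType) (p : I -> {poly F}) :
  exists u : I -> {poly F}, \sum_j u j * p j = \big[@gcdp F/0]_j p j.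
Proof.
apply: (big_ind (fun q => exists u : I -> {poly F}, \sum_j u j * p j = q)).
- by exists (fun _ => 0); rewrite big1 // => j _; rewrite mul0r.
- move=> _ _ [u <-] [v <-]; set q := \sum_j u j * p j; set r := \sum_j _ * _.
  (* [Bezoutp] holds only up to a unit, whence the factor [d^-1 * c] below. *)
  have [[a b] /eqpP[[c d] /andP[/= c_neq0 d_neq0] def_g]] := Bezoutp q r.
  have {def_g} -> : gcdp q r = (d^-1 * c) *: (a * q + b * r).
    by rewrite -scalerA def_g scalerA mulVf // scale1r.
  exists (fun j => (d^-1 * c) *: (a * u j + b * v j)).
  rewrite !mulr_sumr -big_split scaler_sumr; apply: eq_bigr => j _ /=.
  by rewrite -scalerAl mulrDl !mulrA.
- move=> i _; exists (fun j => (j == i)%:R).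
  rewrite (bigD1 i) //= eqxx mul1r big1 ?addr0 // => j /negPf->.
  exact: mul0r.
Qed.

(** * Companion matrices acting on columns and rows *)

Section Companion.
Variables (R : comNzRingType) (n : nat).
Implicit Types f g p q : {poly R}.
Local Notation C f := (companion_col n.+1 f).
Local Notation e k := (delta_mx k 0 : 'cV[R]_n.+1).
Local Notation en := (delta_mx 0 ord_max : 'rV[R]_n.+1).

Lemma map_companion_col (S : nzRingType) (h : {rmorphism R -> S}) f :
  map_mx h (C f) = companion_col n.+1 (map_poly h f).
Proof.
apply/matrixP => i j; rewrite !mxE coef_map.
by case: ifP => _; rewrite ?rmorphN ?rmorph_nat.
Qed.

Lemma companion_colB f g :
  C f - C g = (\col_k (g`_k - f`_k)) *m en.
Proof.
apply/matrixP => i j; rewrite !mxE big_ord1 !mxE eqxx andTb eqSS -val_eqE /=.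
by case: eqP => _; rewrite ?mulr1 ?mulr0 ?subrr // opprK addrC.
Qed.

Lemma companion_col_ord_max f : C f *m e ord_max = - \col_k f`_k.
Proof. by rewrite -colE; apply/colP => i; rewrite !mxE eqxx. Qed.

(** [C f] shifts the canonical basis, which makes [e 0] a cyclic vector. *)
Lemma companion_col_expr f (k : 'I_n.+1) : C f ^+ k *m e 0 = e k.
Proof.
case: k => k; elim: k => [|k IHk] lt_k_n /=.
  by rewrite expr0 mul1mx; congr delta_mx; apply: val_inj.
rewrite exprS -mulmxA (IHk (ltnW lt_k_n)) -colE; apply/colP => i.
rewrite !mxE /= eqSS -val_eqE /= andbT.
by case: eqP => // k_n; rewrite -k_n ltnn in lt_k_n.
Qed.

Lemma horner_companion_col_poly f (a : 'I_n.+1 -> R) :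
  horner_mx (C f) (\sum_k a k *: 'X^k) *m e 0 = \col_k a k.
Proof.
rewrite raddf_sum mulmx_suml; apply/colP => i; rewrite summxE mxE.
rewrite (bigD1 i) //= big1 => [|k /negPf k_i].
  rewrite linearZ /= rmorphXn /= horner_mx_X -scalemxAl companion_col_expr.
  by rewrite !mxE !eqxx mulr1 addr0.
rewrite linearZ /= rmorphXn /= horner_mx_X -scalemxAl companion_col_expr.
by rewrite !mxE [i == k]eq_sym k_i mulr0.
Qed.

Lemma horner_companion_col_surj f (w : 'cV[R]_n.+1) :
  exists p, w = horner_mx (C f) p *m e 0.
Proof.
exists (\sum_k w k 0 *: 'X^k); rewrite horner_companion_col_poly.
by apply/colP => i; rewrite mxE.
Qed.

(** The leading term of [g] sends [e 0] to the last column of [C f], which holds the negated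
    coefficients of [f]. With [companion_colB], this identifies [C f - C g] with g(C_f) e_0 [en]. *)
Lemma horner_companion_col_monic f g : g \is monic -> size g = n.+2 ->
  horner_mx (C f) g *m e 0 = \col_k (g`_k - f`_k).
Proof.
move=> /monicP g_monic g_deg; rewrite -[g in LHS]coefK poly_def g_deg.
have g_lead : g`_n.+1 = 1 by rewrite -g_monic lead_coefE g_deg.
rewrite big_ord_recr /= g_lead scale1r raddfD /= mulmxDl.
rewrite (horner_companion_col_poly f (fun k => g`_k)) rmorphXn /= horner_mx_X.
rewrite exprS -mulmxA (companion_col_expr f ord_max) companion_col_ord_max.
by apply/colP => i; rewrite !mxE.
Qed.

(* The row (1, X, ..., X^n) is an eigenvector modulo f, for the eigenvalue X. *)
Lemma monomials_companion_col f : f \is monic -> size f = n.+2 ->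
  (\row_k 'X^k) *m map_mx polyC (C f) =
    'X *: (\row_k 'X^k) - f *: delta_mx 0 ord_max.
Proof.
move=> /monicP f_monic f_deg; apply/rowP => j; rewrite !mxE.
rewrite -exprS -[j == _]val_eqE /=.
have [j_n|j_n] := eqVneq (j : nat) n; last first.
  have lt_j_n : (j.+1 < n.+1)%N by rewrite ltnS ltn_neqAle j_n -ltnS ltn_ord.
  rewrite mulr0 subr0 (bigD1 (Ordinal lt_j_n)) //= !mxE eqSS (negPf j_n) eqxx.
  rewrite mulr1 big1 ?addr0 // => i; rewrite -val_eqE /= => /negPf i_j.
  by rewrite !mxE eqSS (negPf j_n) i_j mulr0.
(* Last column: as [f] is monic, the sum of the -f_i X^i for i <= n is X^(n+1) - f. *)
have f_lead : f`_n.+1 = 1 by rewrite -f_monic lead_coefE f_deg.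
rewrite j_n mulr1 -[f in RHS]coefK poly_def f_deg.
rewrite [in RHS]big_ord_recr /= f_lead.
rewrite scale1r opprD addrCA subrr addr0 -sumrN; apply: eq_bigr => i _.
by rewrite !mxE j_n eqxx polyCN mulrN mulrC mul_polyC.
Qed.

(** * Subalgebras containing a companion matrix *)

Section Subalgebra.
Variable A : set 'M[R]_n.+1.
Hypothesis algA : mx_subalg A.

Lemma mx_subalg0 : A 0.
Proof.
have [A1 AD _] := algA.
by rewrite -(subrr 1%:M) addrC -scaleN1r; apply: AD.
Qed.

Lemma mx_subalg_sum (I : finType) (B : I -> 'M[R]_n.+1) :
  (forall i, A (B i)) -> A (\sum_i B i).
Proof.
have [_ AD _] := algA => AB; apply: (big_ind A) => //; first exact: mx_subalg0.
by move=> X Y AX AY; rewrite -[X]scale1r; apply: AD.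
Qed.

Lemma mx_subalg_horner (B : 'M[R]_n.+1) p : A B -> A (horner_mx B p).
Proof.
have [A1 AD AM] := algA => AB; elim/poly_ind: p => [|p c IHp].
  by rewrite rmorph0; apply: mx_subalg0.
rewrite rmorphD rmorphM /= horner_mx_X horner_mx_C addrC -scalemx1.
exact/AD/AM.
Qed.

Lemma mx_subalg_full f : A (C f) ->
  (forall u : 'cV[R]_n.+1, A (u *m en)) -> forall B, A B.
Proof.
have [A1 AD AM] := algA => AC Aen.
(* Descending induction on the column index [j], with k = n - j. *)
have Ae k (j : 'I_n.+1) u : (j + k = n)%N -> A (u *m (delta_mx 0 j : 'rV_n.+1)).
  elim: k => [|k IHk] in j u *; rewrite ?addn0 => j_k.
    by rewrite (_ : j = ord_max) //; apply: val_inj.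
  have lt_j_n : (j.+1 < n.+1)%N
    by rewrite ltnS -[X in (_ < X)%N]j_k addnS ltnS leq_addr.
  (* Since j < n, row j+1 of [C f] is e_j^T - f_(j+1) [en]. *)
  have -> : delta_mx 0 j =
      f`_j.+1 *: en + delta_mx 0 (Ordinal lt_j_n) *m C f :> 'rV[R]_n.+1.
    rewrite -rowE; apply/rowP => i; rewrite !mxE -!val_eqE /= !eqSS.
    have [->|_] := eqVneq (i : nat) n; last by rewrite mulr0 add0r eq_sym.
    by rewrite mulr1 subrr gtn_eqF.
  rewrite mulmxDr -scalemxAr; apply: AD => //; rewrite mulmxA; apply: AM => //.
  by apply: IHk; rewrite /= addSnnS.
move=> B; have -> : B = \sum_j col j B *m (delta_mx 0 j : 'rV_n.+1).
  apply/matrixP => i j; rewrite summxE (bigD1 j) //= big1 => [|k /negPf k_j].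
    by rewrite !mxE big_ord1 !mxE !eqxx mulr1 addr0.
  by rewrite !mxE big_ord1 !mxE [j == k]eq_sym k_j andbF mulr0.
apply: mx_subalg_sum => j; apply: (Ae (n - j)%N).
by rewrite subnKC // -ltnS.
Qed.

End Subalgebra.
End Companion.

(** * Coprimality and generation of the full matrix algebra *)

Lemma gen_subalg_companion_full (R : comNzRingType) (n : nat) (I : finType)
    (i0 : I) (f : I -> {poly R}) (A : set 'M[R]_n.+1) :
    (forall i, f i \is monic) -> (forall i, size (f i) = n.+2) ->
    mx_subalg A -> (forall i, A (companion_col n.+1 (f i))) ->
    (forall (M : idealr R) (maxM : maximal_ideal M),
      \big[@gcdp (residue_field maxM)/0]_i map_poly (residue maxM) (f i)
        %= 1) ->
  forall B, A B.
Proof.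
move=> f_monic f_deg algA AC f_coprime; have [A1 AD AM] := algA.
set C := companion_col n.+1 (f i0).
have Af i : A (horner_mx C (f i) *m delta_mx 0 0 *m
               (delta_mx 0 ord_max : 'rV_n.+1)).
  rewrite horner_companion_col_monic // -companion_colB addrC -scaleN1r.
  exact: AD.
suff Aen : forall u : 'cV_n.+1, A (1 *: u *m delta_mx 0 ord_max).
  by apply: (mx_subalg_full algA (AC i0)) => u; rewrite -[u]scale1r.
apply: (@ideal_local_global R
  (fun r => forall u : 'cV_n.+1, A (r *: u *m delta_mx 0 ord_max))).
- by move=> u; rewrite scale0r mul0mx; apply: mx_subalg0.
- move=> a r s Ar As u.
  by rewrite scalerDl -scalerA mulmxDl -scalemxAl; apply: AD.
move=> M maxM.
have [u def_gcd] := big_gcdp_bezout (fun i => map_poly (residue maxM) (f i)).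
have [U def_u] := choice (fun i => map_residue_surj (u i)).
pose p := \sum_i U i * f i; pose B := horner_mx C p.
have [c c_neq0 p_c] : exists2 c, c != 0 & map_poly (residue maxM) p = c%:P.
  have : map_poly (residue maxM) p %= 1.
    rewrite rmorph_sum (eq_bigr _ (fun i _ => rmorphM _ _ _)) /=.
    under eq_bigr do rewrite def_u.
    by rewrite def_gcd f_coprime.
  by rewrite -size_poly_eq1 => /size_poly1P.
(* Over the residue field [B] becomes the scalar matrix [c], so its determinant is a power of
   [c]. *)
exists (\det B) => [w|]; last first.
  rewrite -det_map_mx map_horner_mx p_c horner_mx_C det_scalar.
  by rewrite expf_neq0.
have -> : \det B *: w = B *m (\adj B *m w).
  by rewrite mulmxA mul_mx_adj mul_scalar_mx.
(* By cyclicity (adj B) w = q(C) e_0. Polynomials in [C] commute, so q(C) moves to the left of each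
   f_i(C) and [Af] applies. *)
have [q ->] := horner_companion_col_surj (f i0) (\adj B *m w).
have -> : B *m (horner_mx C q *m delta_mx 0 0) =
    \sum_i horner_mx C (q * U i) *m horner_mx C (f i) *m delta_mx 0 0
      :> 'cV_n.+1.
  rewrite mulmxA -mulmx_suml; congr (_ *m _); rewrite -[LHS]rmorphM /= mulrC.
  rewrite mulr_sumr rmorph_sum; apply: eq_bigr => i _.
  by rewrite mulrA [LHS]rmorphM.
rewrite mulmx_suml; apply: mx_subalg_sum => // i.
rewrite -2!mulmxA; apply: AM; last exact: Af.
exact: (mx_subalg_horner algA _ (AC i0)).
Qed.

(* A common factor g makes every element of the algebra act on
   (1, X, ..., X^n) modulo g as a scalar; the elementary matrix of index
   (0, 1) does so only if g divides 1. *)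
Lemma gen_subalg_companion_coprime (R : comNzRingType) (n : nat) (I : Type)
    (f : I -> {poly R}) (F : fieldType) (h : {rmorphism R -> F})
    (g : {poly F}) :
    (forall i, f i \is monic) -> (forall i, size (f i) = n.+3) ->
    gen_subalg (range (fun i => companion_col n.+2 (f i))) =
      [set: 'M[R]_n.+2]%classic ->
    (forall i, g %| map_poly h (f i)) ->
  g %| 1.
Proof.
move=> f_monic f_deg genf g_f.
pose v : 'rV[{poly F}]_n.+2 := \row_k 'X^k.
pose lift (B : 'M[R]_n.+2) := map_mx polyC (map_mx h B).
(* The term [g *: w] encodes congruence modulo [g] without a quotient ring. *)
pose scalar_mod : set 'M[R]_n.+2 :=
  [set B | exists b w, v *m lift B = b *: v + g *: w]%classic.
have subalg : mx_subalg scalar_mod.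
  split.
  - by exists 1, 0; rewrite /lift !map_mx1 mulmx1 scale1r scaler0 addr0.
  - move=> a B B' [b [w vB]] [b' [w' vB']].
    exists ((h a)%:P * b + b'), ((h a)%:P *: w + w').
    rewrite /lift map_mxD map_mxZ map_mxD map_mxZ mulmxDr -scalemxAr vB vB'.
    by rewrite !scalerDr scalerDl !scalerA addrACA [g * _]mulrC.
  - move=> B B' [b [w vB]] [b' [w' vB']].
    exists (b * b'), (b *: w' + w *m lift B').
    rewrite /lift !map_mxM mulmxA vB mulmxDl -!scalemxAl vB'.
    by rewrite !scalerDr !scalerA addrA [g * b]mulrC.
have /(_ (delta_mx 0 1))[|b [w]] :
  ([set: 'M[R]_n.+2] `<=` scalar_mod)%classic => //.
  rewrite -genf; apply: smallest_sub => // _ [i _ <-].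
  have /dvdpP[q def_f] := g_f i.
  exists 'X, (- q *: delta_mx 0 ord_max).
  rewrite /lift map_companion_col monomials_companion_col ?monic_map //.
    by rewrite scalerA mulrN mulrC -def_f scaleNr.
  by rewrite size_map_poly_id0 // (monicP (f_monic i)) rmorph1 oner_eq0.
rewrite /lift !map_delta_mx => /rowP vE.
have vd j : (v *m (delta_mx 0 1 : 'M_n.+2)) 0 j = (j == 1)%:R.
  rewrite mxE (bigD1 0) //= !mxE eqxx mul1r big1 ?addr0 // => i /negPf i_neq0.
  by rewrite !mxE i_neq0 mulr0.
(* Entry 0 reads 0 = b + g w_0 and entry 1 reads 1 = b X + g w_1, so [g] divides 1. The exponent
   [1 %% n.+2] is the value of the ordinal 1. *)
move: (vE 0) (vE 1); rewrite !vd !mxE /= mulr1 => /eqP.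
rewrite eq_sym addr_eq0 => /eqP-> def1; apply/dvdpP.
exists (w 0 1 - w 0 0 * 'X^(1 %% n.+2)); rewrite [LHS]def1.
by rewrite mulrBl mulNr addrC [w 0 1 * g]mulrC [g * w 0 0]mulrC mulrAC.
Qed.

Theorem theorem5p1 (R : comNzRingType) (n m : nat) (hn : (2 <= n)%N)
    (hm : (2 <= m)%N) (f : 'I_m -> {poly R})
    (f_monic : forall i, f i \is monic)
    (f_deg : forall i, size (f i) = n.+1) :
  gen_subalg (range (fun i => companion_col n (f i))) = [set: 'M[R]_n]%classic
  <->
  forall (M : idealr R) (maxM : maximal_ideal M),
    \big[@gcdp (residue_field maxM)/0]_(i < m) map_poly (residue maxM) (f i)
      %= 1.
Proof.
case: n => [|[|n]] // in hn f_deg *; split=> [genf M maxM | f_coprime].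
  rewrite /eqp dvd1p andbT.
  apply: (gen_subalg_companion_coprime (h := residue maxM) f_monic f_deg genf).
  by move=> i; apply: big_gcdp_dvd.
apply/seteqP; split=> // B _ A [algA sCA].
pose i0 := Ordinal (ltnW hm).
apply: (gen_subalg_companion_full i0 f_monic f_deg algA) => // i.
by apply: sCA; exists i.
Qed.
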